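(* Let $n$ be a positive integer and let $q \equiv 1 \pmod n$ be a prime power. Let $\chi_n \in \widehat{\mathbb{F}_q^{*}}$ be a character of order $n$. Let $A_1, \dots, A_m, B_1, \dots, B_m \in \widehat{\mathbb{F}_q^{*}}$. If $\lambda \in \mathbb{F}_q$ is not an $n$-th power in $\mathbb{F}_q$, then $${}_{nm}F_{nm}\left( \begin{array}{c} A_i \chi_n^l : 1 \leq i \leq m,\ 0 \leq l \leq n-1 \\ B_i \chi_n^l : 1 \leq i \leq m,\ 0 \leq l \leq n-1 \end{array} \Big| \; \lambda \right)_{q}=0.$$
   Context: $\mathbb{F}_q$ is the finite field with $q$ elements and $\widehat{\mathbb{F}_q^*}$ the group of (complex) multiplicative characters of $\mathbb{F}_q^*$; every $\chi\in\widehat{\mathbb{F}_q^*}$, including the trivial character $\varepsilon$, is extended to $\mathbb{F}_q$ by $\chi(0):=0$, and $\overline{\chi}$ denotes the inverse of $\chi$. Fix a non-trivial additive character $\theta$ of $\mathbb{F}_q$ and define the Gauss sum $g(\chi):=\sum_{x\in\mathbb{F}_q}\chi(x)\theta(x)$. For $A_1,\dots,A_m,B_1,\dots,B_m\in\widehat{\mathbb{F}_q^*}$ and $\lambda\in\mathbb{F}_q$, the finite field hypergeometric function is $${}_{m}F_{m}\left( \begin{array}{cccc} A_1, & A_2, & \dots, & A_m \\ B_1, & B_2, & \dots, & B_m \end{array} \Big| \; \lambda \right)_{q} := \frac{-1}{q-1} \sum_{\chi \in \widehat{\mathbb{F}_q^{*}}} \prod_{i=1}^{m} \frac{g(A_i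 \chi)}{g(A_i)} \frac{g(\overline{B_i \chi})}{g(\overline{B_i})}\, \chi(-1)^{m} \chi(\lambda).$$ *)

(* Defs.v *)
From HB Require Import structures.
From mathcomp Require Import all_boot all_order all_algebra all_fingroup.
From mathcomp Require Import all_solvable all_field all_character.

Set Implicit Arguments.
Unset Strict Implicit.
Unset Printing Implicit Defensive.

Import GRing.Theory Num.Theory.
Local Open Scope ring_scope.

(* Multiplicative characters of F are the linear characters of its unit group.
   Additive characters are the linear characters of [set: F]: the canonical
   group law of the finZmodType F is its addition (add_charD below).  Values
   lie in algC, which contains all roots of unity. *)
Notation mul_cfun F := 'CF([set: {unit F%type}]) (only parsing).
Notation add_cfun F := 'CF([set: F%type]) (only parsing).

(* Extension by 0 to the whole field; it also sends 0 to 0 when chi = 1. *)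
Definition mul_char_ext (F : finFieldType) (chi : mul_cfun F) (x : F) : algC :=
  if insub x is Some u then chi u else 0.

Definition gauss_sum (F : finFieldType) (theta : add_cfun F)
    (chi : mul_cfun F) : algC :=
  \sum_(x : F) mul_char_ext chi x * theta x.

(* The sum over the dual of the unit group is taken over [irr], which
   enumerates exactly its linear characters, once each (mem_irr_unit and
   irr_unit_uniq below).  [chi^-1] is the inverse of chi for the pointwise
   product of class functions. *)
Definition hypergeomFF (F : finFieldType) (theta : add_cfun F) (m : nat)
    (A B : m.-tuple (mul_cfun F)) (lambda : F) : algC :=
  - 1 / (#|F|%:R - 1) *
  \sum_(chi <- irr [set: {unit F}])
     (\prod_(i < m)
        (gauss_sum theta (tnth A i * chi) / gauss_sum theta (tnth A i) *
         (gauss_sum theta ((tnth B i * chi)^-1) /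
          gauss_sum theta ((tnth B i)^-1)))) *
     mul_char_ext chi (-1) ^+ m * mul_char_ext chi lambda.

(* The list A_i * chi ^ l with 1 <= i <= m and 0 <= l < n. *)
Definition twists (F : finFieldType) (n : nat) (chi : mul_cfun F) (m : nat)
    (A : m.-tuple (mul_cfun F)) : (m * n).-tuple (mul_cfun F) :=
  allpairs_tuple (fun a l => a * chi ^+ l) A (iota_tuple n 0).

Lemma add_charD (F : finFieldType) (theta : add_cfun F) (x y : F) :
  theta \is a linear_char -> theta (x + y) = theta x * theta y.
Proof. by move=> th_lin; rewrite -(lin_charM th_lin) ?inE. Qed.

Lemma mem_irr_unit (F : finFieldType) (chi : mul_cfun F) :
  (chi \in irr [set: {unit F}]) = (chi \is a linear_char).
Proof.
apply/idP/idP => [/irrP [i ->] | /lin_char_irr //].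
apply/char_abelianP/centsP => u _ v _.
by apply: val_inj; rewrite /= mulrC.
Qed.

Lemma irr_unit_uniq (F : finFieldType) : uniq (irr [set: {unit F}]).
Proof. exact: free_uniq (irr_free _). Qed.

(* Main.v *)
(* Replacing psi by psi * chi_n permutes the summands of the hypergeometric sum
   and only rotates the products of Gauss sums over the twists by powers of
   chi_n.  Since chi_n(-1) ^ n = 1, the sum equals chi_n(lambda) times itself;
   but chi_n(lambda) <> 1, because an element of the cyclic unit group killed by
   a character of order n is an n-th power. *)
Require Import Defs.
From HB Require Import structures.
From mathcomp Require Import all_boot all_order all_algebra all_fingroup.
From mathcomp Require Import all_solvable all_field all_character.

Set Implicit Arguments.
Unset Strict Implicit.
Unset Printing Implicit Defensive.

Import GRing.Theory Num.Theory.
Local Open Scope ring_scope.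

Section ShiftedProducts.

Variables (F : finFieldType) (n : nat) (chi : mul_cfun F).
Hypothesis chi_expn : chi ^+ n = 1.

(** For each entry [a], multiplying by [chi] moves every twist [a * chi ^+ l] to the next one, and
    [chi ^+ n = 1] closes the cycle. Keeping [f] arbitrary covers both Gauss sums, at a character
    and at its inverse. *)
Lemma prod_twists_shift (m : nat) (A : m.-tuple (mul_cfun F))
    (f : mul_cfun F -> algC) (psi : mul_cfun F) :
  \prod_(i < m * n) f (tnth (twists n chi A) i * (psi * chi)) =
  \prod_(i < m * n) f (tnth (twists n chi A) i * psi).
Proof.
have twistsE g : \prod_(i < m * n) g (tnth (twists n chi A) i) =
    \prod_(a <- A) \prod_(0 <= l < n) g (a * chi ^+ l) :> algC.
  rewrite -(big_tuple _ _ (twists n chi A) xpredT g) big_allpairs_dep.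
  by rewrite /index_iota subn0.
rewrite (twistsE (fun c => f (c * (psi * chi)))) (twistsE (fun c => f (c * psi))).
apply: eq_bigr => a _.
under eq_bigr => l _ do
  rewrite [psi * chi]mulrC mulrA -[a * _ * chi]mulrA -exprSr.
case: n chi_expn => [|k chi_exp1]; first by rewrite !big_geq.
(* The last factor on the left, at exponent [k.+1], is the first one on the right, at exponent 0;
   the others agree term by term. *)
by rewrite big_nat_recr // big_nat_recl //= chi_exp1 expr0 mulrC.
Qed.

Lemma mul_char_extM (phi psi : mul_cfun F) (x : F) :
  mul_char_ext (phi * psi) x = mul_char_ext phi x * mul_char_ext psi x.
Proof. by rewrite /mul_char_ext; case: insubP => *; rewrite ?cfunE ?mul0r. Qed.

Lemma mul_char_ext_val (phi : mul_cfun F) (u : {unit F}) :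
  mul_char_ext phi (val u) = phi u.
Proof. by rewrite /mul_char_ext valK. Qed.

Lemma mul_char_ext_expn (x : F) : x != 0 -> mul_char_ext chi x ^+ n = 1.
Proof.
rewrite -unitfE => Ux; rewrite -[x]/(val (FinRing.unit F Ux)) mul_char_ext_val.
by rewrite -exp_cfunE ?inE // chi_expn cfun1E inE.
Qed.

End ShiftedProducts.

(* At a generator x of the cyclic unit group, chi x has the same order as chi;
   so chi (x ^ k) = 1 only when that order divides k. *)
Lemma lin_char_eq1_expn (F : finFieldType) (chi : mul_cfun F) (u : {unit F}) :
  chi \is a linear_char -> chi u = 1 ->
  exists v : {unit F}, u = (v ^+ #[chi]%CF)%g.
Proof.
move=> chi_lin chi_u.
have /cyclicP[x defU] := field_unit_group_cyclic [set: {unit F}]%G.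
have cycU v : exists k, v = (x ^+ k)%g by apply/cycleP; rewrite -defU inE.
have [k def_u] := cycU u; have chi_xk : chi x ^+ k = 1.
  by rewrite -lin_charX ?inE // -def_u.
suffices /dvdnP[j def_k] : (#[chi]%CF %| k)%N.
  by exists (x ^+ j)%g; rewrite -expgM -def_k.
apply/dvdn_cforderP => v _; have [l ->] := cycU v.
by rewrite lin_charX ?inE // exprAC chi_xk expr1n.
Qed.

(** A linear [chi] is invertible, so multiplication by it is an injective map of the finite list of
    characters into itself, hence a permutation. *)
Lemma sum_irr_unit_shift (F : finFieldType) (chi : mul_cfun F)
    (f : mul_cfun F -> algC) : chi \is a linear_char ->
  \sum_(psi <- irr [set: {unit F}]) f (psi * chi) =
  \sum_(psi <- irr [set: {unit F}]) f psi.
Proof.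
move=> chi_lin; rewrite -(big_map (fun psi => psi * chi) xpredT f).
set s := map _ _; have Us : uniq s.
  rewrite map_inj_uniq ?irr_unit_uniq //.
  by apply/mulIr/lin_char_unitr.
have sub_s : {subset s <= irr [set: {unit F}]}.
  by move=> _ /mapP[psi irr_psi ->]; rewrite mulrC mul_lin_irr.
apply/perm_big/uniq_perm; rewrite ?irr_unit_uniq //.
by have [] := uniq_min_size Us sub_s; rewrite ?size_map.
Qed.

Theorem theorem2p2 (F : finFieldType)
    (theta : add_cfun F) (theta_lin : theta \is a linear_char)
    (theta_nontriv : theta != 1)
    (n : nat) (n_gt0 : (0 < n)%N) (qn : #|F| = 1 %[mod n])
    (chi_n : mul_cfun F) (chi_n_lin : chi_n \is a linear_char)
    (chi_n_order : #[chi_n]%CF = n)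
    (m : nat) (A B : m.-tuple (mul_cfun F))
    (A_lin : forall i : 'I_m, tnth A i \is a linear_char)
    (B_lin : forall i : 'I_m, tnth B i \is a linear_char)
    (lambda : F) (lambda_nonpower : ~ exists mu : F, lambda = mu ^+ n) :
  hypergeomFF theta (twists n chi_n A) (twists n chi_n B) lambda = 0.
Proof.
have chi_n_expn : chi_n ^+ n = 1 by rewrite -chi_n_order exp_cforder.
have lambda_neq0 : lambda != 0.
  apply/eqP => lambda0; apply: lambda_nonpower.
  (* Here [0 < n] matters: it makes 0 its own [n]-th power. *)
  by exists 0; rewrite lambda0 expr0n gtn_eqF.
have chi_lambda_neq1 : mul_char_ext chi_n lambda != 1.
  have Ulambda : lambda \is a GRing.unit by rewrite unitfE.
  rewrite -[lambda]/(val (FinRing.unit F Ulambda)) mul_char_ext_val.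
  apply/eqP => /(lin_char_eq1_expn chi_n_lin); rewrite chi_n_order => -[v def_v].
  by apply: lambda_nonpower; exists (val v); rewrite -FinRing.val_unitX -def_v.
rewrite /hypergeomFF; set S := \sum_(chi <- _) _.
suffices S_fixed : S = S * mul_char_ext chi_n lambda.
  apply/eqP; rewrite mulf_eq0 orbC; apply/orP; left.
  move/eqP: S_fixed; rewrite -subr_eq0 -[X in X - _]mulr1 -mulrBr mulf_eq0.
  by rewrite subr_eq0 [1 == _]eq_sym (negPf chi_lambda_neq1) orbF.
(* Only the left copy of [S] is reindexed; the two sums are then compared term by term. *)
rewrite {1}/S -(sum_irr_unit_shift _ chi_n_lin) mulr_suml.
apply: eq_bigr => psi _; rewrite !mul_char_extM exprMn.
have -> : mul_char_ext chi_n (-1) ^+ (m * n) = 1.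
  by rewrite mulnC exprM mul_char_ext_expn ?expr1n // oppr_eq0 oner_eq0.
rewrite mulr1 mulrA; congr (_ * _ * _ * _).
(* Splitting isolates the numerators, which are invariant under the shift; the denominators do not
   involve [psi]. *)
rewrite !big_split /=.
by rewrite prod_twists_shift //
  (prod_twists_shift _ _ (fun c => gauss_sum theta c^-1)).
Qed.
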